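(* Let $k,n$ be integers with $k\geq 3$ and $n\geq 1$. Let $G$ be a balanced $k$-partite graph of order $p=kn$. If $G$ has at least $$\frac{(k^2-k)n^2-2n(k-1)+4}{2}$$ edges, then $G$ is chorded pancyclic.
   Context: All graphs are finite and simple. A graph is $k$-partite if its vertex set can be partitioned into $k$ disjoint parts such that vertices in the same part are not adjacent; it is balanced if all the parts have the same number of vertices (so a balanced $k$-partite graph of order $kn$ has $n$ vertices in each part). A chord of a cycle $C$ in $G$ is an edge of $G$ joining two non-consecutive vertices of $C$; a cycle with $t$ vertices having a chord is a chorded $t$-cycle. A graph of order $p$ is chorded pancyclic if it contains a chorded $t$-cycle for every integer $t$ with $4\leq t\leq p$ (a vacuous condition if $p=3$). *)

(* Defs.v *)
From mathcomp Require Import all_boot.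

Set Implicit Arguments.
Unset Strict Implicit.
Unset Printing Implicit Defensive.

(* A finite simple graph is a symmetric irreflexive relation e on a finType. *)

Section Graphs.
Variables (T : finType) (e : rel T).

Definition edges : {set {set T}} := [set [set x; y] | x in T, y in e x].

(* The parts are the fibres of f, so a k-partite graph may have empty parts. *)
Definition kpartition (k : nat) (f : T -> 'I_k) : Prop :=
  forall x y, e x y -> f x != f y.

Definition balanced_kpartite (k : nat) : Prop :=
  exists2 f : T -> 'I_k, kpartition f &
    forall i j : 'I_k, #|[set x | f x == i]| = #|[set x | f x == j]|.

(* The sequence c lists the vertices in cyclic order; without the bound on its
   size, sequences of length 0 and 2 could count as cycles. *)
Definition graph_cycle (c : seq T) : Prop := ucycle e c /\ 3 <= size c.

Definition chord (c : seq T) (x y : T) : Prop :=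
  [/\ x \in c, y \in c, e x y, y != next c x & x != next c y].

Definition chorded_cycle (t : nat) : Prop :=
  exists c : seq T, [/\ graph_cycle c, size c = t & exists x y, chord c x y].

Definition chorded_pancyclic : Prop :=
  forall t, 4 <= t <= #|T| -> chorded_cycle t.

End Graphs.

(* Main.v *)
Require Import Defs.
From mathcomp Require Import all_boot all_order all_algebra.
From mathcomp Require Import zify lra.
Set Implicit Arguments.
Unset Strict Implicit.
Unset Printing Implicit Defensive.

(** Call a pair of vertices missing if it lies in two different parts but is not
    an edge, let r x be the number of missing pairs at x, and put p = kn.  The
    edge bound says that at most p - n - 2 pairs are missing.  The argument only
    uses that the parts have at most n vertices and that 3n <= p; edges inside
    parts are welcome, which is what makes an induction on added edges possible.

    Hamiltonicity ([hamiltonian_of_few_missing]).  If every part has at most s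
    vertices, 2s <= t, and at most t - s - 2 pairs are missing, then a graph on t
    vertices is Hamiltonian.  Take a nonadjacent pair u, v with deg u <= deg v
    and the largest degree sum.  If deg u + deg v >= t, adding the edge uv does
    not affect Hamiltonicity (Bondy and Chvatal), and the induction goes on up to
    the complete graph.  Otherwise v has at least deg u non-neighbours, all of
    degree at most deg u by the choice of the pair, so each of them misses at
    least t - s - deg u vertices.  If some of them are in the part of v, the
    missing pairs at those and at v are distinct and too many; if none is, then v
    misses all of them, and the missing pairs at u or v are already too many.

    Other lengths.  If a vertex v outside a cycle c of length q is adjacent to
    more than 3q/5 of its vertices, then v together with a suitable arc of c is a
    chorded cycle, for every length from 5 to q + 1 ([chorded_around]): otherwise
    many arcs have both ends adjacent to v, but then the first two inner vertices
    of each are not, and these non-neighbours are too numerous.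

    As r is less than 2 on average, there are two ways to find such v and c.  If
    r x = 1 for some x, deleting x removes one missing pair, so the rest has a
    Hamiltonian cycle, and v = x works.  If r never takes the value 1, some v has
    r v = 0; the rest without v and a vertex x with r x >= 2 (any x if nothing is
    missing) has a Hamiltonian cycle.  In the first way the density condition can
    fail, but only for n = 2, p = 6; then length 5 is that of the Hamiltonian cycle
    of the rest, which has a chord.  For length 4, any triangle will do, such as v
    and two consecutive vertices of c: the missing pairs at its three vertices are
    distinct, so its degree sum exceeds p + 3 and some outside vertex sees two of
    its vertices.  For length p, use Hamiltonicity and a vertex of degree at
    least 3. *)

(** * Degrees, missing pairs and pair counts *)

Definition degree (T : finType) (r : rel T) (x : T) : nat := #|[set y | r x y]|.

Definition missing (T : finType) (I : eqType) (e : rel T) (f : T -> I) : rel T :=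
  fun x y => (f x != f y) && ~~ e x y.

(** Ordered pairs are counted, so an edge with both ends in [A :&: B]
    counts twice. *)
Definition arcs (T : finType) (r : rel T) (A B : {set T}) : nat :=
  \sum_(x in A) \sum_(y in B) r x y.

Section Counting.
Variables (T : finType) (r : rel T).

Lemma degreeE x : degree r x = \sum_y r x y.
Proof.
rewrite /degree -sum1dep_card big_mkcond.
by apply: eq_bigr => y _; case: (r x y).
Qed.

Lemma arcs_setT (A : {set T}) : arcs r A setT = \sum_(x in A) degree r x.
Proof.
by apply: eq_bigr => x _; rewrite degreeE; apply: eq_bigl => y; rewrite inE.
Qed.

Lemma arcs_split (A W : {set T}) : arcs r A setT = arcs r A W + arcs r A (~: W).
Proof.
rewrite /arcs -big_split /=; apply: eq_bigr => x _.
rewrite (bigID (mem W)) /=; congr (_ + _); apply: eq_bigl => y; by rewrite !inE.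
Qed.

Hypothesis r_sym : symmetric r.

Lemma arcsC (A B : {set T}) : arcs r A B = arcs r B A.
Proof.
rewrite /arcs exchange_big /=; apply: eq_bigr => x _.
by apply: eq_bigr => y _; rewrite r_sym.
Qed.

(** Deleting [W] removes every pair with an end in [W]; the degrees on [W] count those
    inside [W] at both ends.  This serves twice: it gives the number of
    missing pairs left after a deletion, and it bounds the degrees on [W] by the total. *)
Lemma arcs_compl (W : {set T}) :
  \sum_x degree r x + arcs r W W
  = 2 * \sum_(x in W) degree r x + arcs r (~: W) (~: W).
Proof.
have -> : \sum_x degree r x = arcs r setT setT.
  by rewrite arcs_setT; apply: eq_bigl => x; rewrite inE.
rewrite -arcs_setT (arcs_split _ W) [arcs r setT W]arcsC [arcs r setT (~: W)]arcsC.
rewrite !(arcs_split _ W) [arcs r (~: W) W]arcsC.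
lia.
Qed.

Lemma arcs_stable (W : {set T}) :
  {in W &, forall x y, ~~ r x y} -> arcs r W W = 0.
Proof.
move=> W0; rewrite /arcs big1 // => x xW.
by rewrite big1 // => y yW; rewrite (negbTE (W0 x y _ _)).
Qed.

(** The edges at the vertices of a stable set are distinct. *)
Lemma degree_sum_stable (W : {set T}) :
  {in W &, forall x y, ~~ r x y} ->
  2 * \sum_(x in W) degree r x <= \sum_x degree r x.
Proof. by move=> /arcs_stable W0; have := arcs_compl W; rewrite W0; lia. Qed.

End Counting.

Lemma degree_missing (T : finType) (I : eqType) (e : rel T) (f : T -> I) s x :
  #|[set y | f y == f x]| <= s -> #|T| <= degree e x + degree (missing e f) x + s.
Proof.
move=> cls; have -> : #|T| = #|[set: T]| by rewrite cardsT.
have cover : [set: T] \subset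
    [set y | e x y] :|: [set y | missing e f x y] :|: [set y | f y == f x].
  apply/subsetP=> y _; rewrite !inE /missing [f y == _]eq_sym.
  by case: (f x == f y); case: (e x y).
apply: leq_trans (subset_leq_card cover) _.
apply: leq_trans (leq_card_setU _ _) _; apply: leq_add cls.
exact: leq_card_setU.
Qed.

(** * The Bondy-Chvatal closure step *)

Lemma count_card (T : finType) (c : seq T) (P : pred T) :
  uniq c -> count P c = #|[set y in c | P y]|.
Proof.
move=> uc; rewrite -size_filter cardE; apply/perm_size/uniq_perm.
- exact: filter_uniq.
- exact: enum_uniq.
by move=> y; rewrite mem_filter mem_enum inE andbC.
Qed.

Lemma spanning_mem (T : finType) (c : seq T) x :
  uniq c -> size c = #|T| -> x \in c.
Proof.
move=> uc szc; have sub_c : {subset c <= enum T} by move=> y _; rewrite mem_enum.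
by have [|_ ->] := uniq_min_size uc sub_c; rewrite ?mem_enum // szc cardE.
Qed.

Lemma count_spanning (T : finType) (c : seq T) (P : pred T) :
  uniq c -> size c = #|T| -> count P c = #|[set y | P y]|.
Proof.
move=> uc szc; rewrite count_card //; apply: eq_card => y.
by rewrite !inE spanning_mem.
Qed.

(** [belast a p] lists the predecessors, in [a :: p], of the entries of [p]. *)
Lemma consecutive_pigeonhole (T : eqType) (P Q : pred T) (a : T) (p : seq T) :
  size p < count P p + count Q (belast a p) ->
  exists p1 b p2, [/\ p = p1 ++ b :: p2, P b & Q (last a p1)].
Proof.
elim: p a => [|b p IHp] a //=.
case Pb: (P b); case Qa: (Q a); first by exists [::], b, p.
all: rewrite /= => szp; have [|p1 [d [p2 [-> Pd Qd]]]] := IHp b; first by lia.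
all: by exists (b :: p1), d, p2.
Qed.

Section Closure.
Variables (T : finType) (e : rel T).
Hypotheses (e_sym : symmetric e) (e_irr : irreflexive e).

Definition hamiltonian (r : rel T) := exists2 c : seq T, ucycle r c & size c = #|T|.

(** Ore's crossing argument: some edge from [x] ends at the successor on the path of
    a neighbour of [last x p]; going along the path to that neighbour, jumping to the
    end and coming back closes a spanning cycle. *)
Lemma hamiltonian_of_path x p :
  path e x p -> uniq (x :: p) -> size (x :: p) = #|T| ->
  #|T| <= degree e x + degree e (last x p) -> hamiltonian e.
Proof.
move=> pathp up szp degxy.
have := count_spanning (e x) up szp; rewrite /= e_irr add0n => degx.
have := count_spanning (e (last x p)) up szp.
rewrite lastI -cats1 count_cat /= e_irr !addn0 => degy.
(* Neither end of the path is its own neighbour, so all neighbours of [x] are in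
   [p], and all those of [last x p] in [belast x p]. *)
have [|p1 [b [p2 [Dp exb ey]]]] :=
    @consecutive_pigeonhole _ (e x) (e (last x p)) x p.
  by move: degxy; rewrite /degree -degx -degy -szp.
move: pathp up szp ey; rewrite {}Dp cat_path last_cat /= => /and3P[pp1 pab pp2] up szp ey.
have perm_c : perm_eq (x :: p1 ++ rev (b :: p2)) (x :: p1 ++ b :: p2).
  by rewrite perm_cons perm_cat2l perm_rev.
exists (x :: p1 ++ rev (b :: p2)); last by rewrite (perm_size perm_c).
rewrite /ucycle (perm_uniq perm_c) /= up andbT rcons_cat cat_path pp1 /=.
rewrite -rev_cons (lastI x (b :: p2)) rev_rcons.
rewrite /= e_sym. rewrite ey /=.
have := rev_path e x (b :: p2); rewrite /= => ->.
by rewrite e_sym exb /=; apply: sub_path pp2 => y z; rewrite e_sym.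
Qed.

Definition add_edge (u v : T) : rel T :=
  fun x y => [|| e x y, (x == u) && (y == v) | (x == v) && (y == u)].

(** Cutting the cycle at its passage from [u] to [v] leaves a spanning path from [v] to
    [u] that only uses edges of [e]. *)
Lemma hamiltonian_of_cycle_through u v c :
  u != v -> #|T| <= degree e u + degree e v -> 2 < #|T| ->
  ucycle (add_edge u v) c -> size c = #|T| -> next c u = v -> hamiltonian e.
Proof.
move=> uv deguv gtT /andP[cyc uc] szc nu.
have [i p Dp] := rot_to (spanning_mem u uc szc).
rewrite -(next_rot i uc) Dp in nu.
rewrite -(rot_cycle i) Dp in cyc.
rewrite -(size_rot i) Dp in szc.
rewrite -(rot_uniq i) {i}Dp in uc.
case: p => [|w p] in cyc uc szc nu *; first by move: gtT; rewrite -szc.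
rewrite /= eqxx in nu; subst w.
move: cyc => /= /andP[_]; rewrite rcons_path => /andP[pp lastp].
move: uc => /= /and3P[up vp uniqp].
have{} up : u \notin p by move: up; rewrite inE; case/norP.
apply: (@hamiltonian_of_path v (rcons p u)).
- rewrite rcons_path; apply/andP; split.
    apply: (sub_in_path (P := predC1 u)) pp; last first.
      by rewrite /= eq_sym uv; apply/allP=> z zp /=; apply: contraNneq up => <-.
    move=> a b /=; rewrite !inE /add_edge => au bu.
    by rewrite (negbTE au) (negbTE bu) !andbF /= orbF.
  case: p => [|w p] in szc pp lastp up vp uniqp *; first by move: gtT; rewrite -szc.
  have lw : last v (w :: p) \in w :: p by rewrite /= mem_last.
  move: lastp; rewrite /add_edge (negbTE (memPn vp _ lw)).
  by rewrite (negbTE (memPn up _ lw)) /= orbF.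
- by rewrite /= rcons_uniq mem_rcons inE negb_or eq_sym uv vp up uniqp.
- by rewrite /= size_rcons.
by rewrite last_rcons addnC.
Qed.

Lemma add_edgeC u v : add_edge u v =2 add_edge v u.
Proof. by move=> x y; rewrite /add_edge [X in _ || X]orbC. Qed.

Lemma hamiltonian_add_edge u v :
  u != v -> #|T| <= degree e u + degree e v -> 2 < #|T| ->
  hamiltonian (add_edge u v) -> hamiltonian e.
Proof.
move=> uv deguv gtT [c ec szc].
have [nu|nu] := eqVneq (next c u) v.
  exact: hamiltonian_of_cycle_through nu.
have [nv|nv] := eqVneq (next c v) u.
  apply: (@hamiltonian_of_cycle_through v u c) => //; first by rewrite eq_sym.
    by rewrite addnC.
  by move: ec; rewrite /ucycle (eq_cycle (add_edgeC u v)).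
exists c => //; move/andP: ec => [cyc uc].
rewrite /ucycle uc andbT; apply: cycle_from_next => // x xc.
have := next_cycle cyc xc; rewrite /add_edge => /or3P[] // /andP[/eqP Dx /eqP Dn].
  by rewrite -Dx Dn eqxx in nu.
by rewrite -Dx Dn eqxx in nv.
Qed.

Lemma hamiltonian_complete :
  2 < #|T| -> (forall x y, x != y -> e x y) -> hamiltonian e.
Proof.
move=> gtT complete; exists (enum T); last by rewrite -cardE.
have := enum_uniq T; have : 2 < size (enum T) by rewrite -cardE.
case: (enum T) => [|x p] //= szp /andP[xp up].
rewrite /ucycle /= xp up !andbT rcons_path.
apply/andP; split.
  have : sorted e (x :: p).
    apply: pairwise_sorted; rewrite /= ?xp; apply/andP; split.
      by apply/allP=> y yp; apply: complete; apply: contraNneq xp => ->.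
    by move: up; rewrite uniq_pairwise; apply: sub_pairwise => y z; apply: complete.
  by [].
case: p => // y p in szp xp up *; apply: complete.
by have /= := mem_last y p; apply: contraTneq => ->.
Qed.

End Closure.

(** * Hamiltonicity with few missing pairs *)

Section FewMissing.
Variables (T : finType) (I : eqType) (f : T -> I) (s : nat).
Hypothesis class_le : forall x, #|[set y | f y == f x]| <= s.
Hypothesis s_half : 2 * s <= #|T|.

Lemma missing_sym (e : rel T) : symmetric e -> symmetric (missing e f).
Proof. by move=> e_sym x y; rewrite /missing eq_sym e_sym. Qed.

(** The counting step: a nonadjacent pair of largest degree sum satisfies the
    condition of the closure step.  Otherwise let [h] be the degree of [u]; there are at
    least [h] non-neighbours of [v], all of degree at most [h], and [h < #|T| - s]
    because [2 * s <= #|T|]. *)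
Lemma degree_sum_of_extremal (e : rel T) u v :
  symmetric e -> irreflexive e ->
  \sum_x degree (missing e f) x + 2 * s + 4 <= 2 * #|T| ->
  u != v -> ~~ e u v -> degree e u <= degree e v ->
  (forall w, w != v -> ~~ e w v -> degree e w <= degree e u) ->
  #|T| <= degree e u + degree e v.
Proof.
move=> e_sym e_irr few uv euv degle extremal.
rewrite leqNgt; apply/negP => deg_lt.
pose r := missing e f.
have r_sym : symmetric r := missing_sym e_sym.
rewrite -/r in few.
pose Z1 := [set w | [&& w != v, ~~ e v w & f w == f v]].
pose Z2 := [set w | r v w].
have degv : #|T| <= degree e v + #|Z2| + #|Z1| + 1.
  have cover : [set: T] \subset [set w | e v w] :|: Z2 :|: Z1 :|: [set v].
    apply/subsetP=> w _; rewrite !inE /r /missing [f v == _]eq_sym.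
    by case: (w == v); case: (e v w); case: (f w == f v).
  rewrite -cardsT (leq_trans (subset_leq_card cover)) //.
  rewrite -(cards1 v); do 3!(apply: leq_trans (leq_card_setU _ _) _; apply: leq_add => //).
have degZ w : w != v -> ~~ e w v -> #|T| <= degree e u + degree r w + s.
  move=> wv ewv; apply: leq_trans (degree_missing e (class_le w)) _.
  by rewrite !leq_add2r extremal.
have [Z0|[w wZ]] := set_0Vmem Z1.
(* [v] misses at least [h] vertices and [u] at least [#|T| - s - h]; only the pair of
   [u] and [v] can be counted at both. *)
- have ruu : r u u = false by rewrite /r /missing eqxx.
  have rvv : r v v = false by rewrite /r /missing eqxx.
  have := arcs_compl r_sym [set u; v]; rewrite /arcs.
  rewrite !big_setU1 ?inE //= !big_set1 !big_setU1 ?inE //= !big_set1.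
  rewrite ruu rvv; have := degZ u uv euv.
  have -> : degree r v = #|Z2| by [].
  move: degv; rewrite Z0 cards0.
  by have := leq_b1 (r u v); have := leq_b1 (r v u); lia.
(* Each vertex of [Z1] misses at least [#|T| - s - h >= 1] vertices and [v] misses
   [#|Z2|]; these pairs are distinct as [v |: Z1] lies in one part. *)
- have vZ1 : v \notin Z1 by rewrite inE eqxx.
  have W0 : {in v |: Z1 &, forall x y, ~~ r x y}.
    move=> x y; rewrite !inE /r /missing => xW yW.
    have -> : f x = f v by case/predU1P: xW => [->|/and3P[_ _ /eqP]].
    have -> : f y = f v by case/predU1P: yW => [->|/and3P[_ _ /eqP]].
    by rewrite eqxx.
  have := degree_sum_stable r_sym W0; rewrite big_setU1 //=.
  have : \sum_(x in Z1) (#|T| - s - degree e u) <= \sum_(x in Z1) degree r x.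
    apply: leq_sum => x; rewrite inE => /and3P[xv evx _].
    by have := degZ x xv; rewrite e_sym => /(_ evx); lia.
  rewrite sum_nat_const; have -> : degree r v = #|Z2| by [].
  have : 0 < #|Z1| by apply/card_gt0P; exists w.
  have K_gt0 : 0 < #|T| - s - degree e u by lia.
  move DK : (#|T| - s - degree e u) K_gt0 => K K_gt0 Z1_gt0 sumZ1.
  (* The product of two positive numbers is at least their sum minus one. *)
  have : #|Z1| + K <= #|Z1| * K + 1 by nia.
  lia.
Qed.

Lemma hamiltonian_of_few_missing (e : rel T) :
  symmetric e -> irreflexive e ->
  \sum_x degree (missing e f) x + 2 * s + 4 <= 2 * #|T| ->
  hamiltonian e.
Proof.
have [N] := ubnP #|[set z : T * T | ~~ e z.1 z.2]|.
elim: N e => // N IHN e ltN e_sym e_irr few.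
have gtT : 2 < #|T|.
  have /card_gt0P[x _] : 0 < #|T| by lia.
  have := class_le x; rewrite (cardsD1 x) inE eqxx.
  by lia.
pose nonadj (z : T * T) := (z.1 != z.2) && ~~ e z.1 z.2.
have [z0 nz0|all_adj] := pickP nonadj; last first.
  apply: hamiltonian_complete => // x y xy.
  by have := all_adj (x, y); rewrite /nonadj /= xy /= => /negbFE.
have [[u v] uvP maxuv] := arg_maxnP (fun z => degree e z.1 + degree e z.2) nz0.
rewrite /= in maxuv.
wlog degle : u v uvP maxuv / degree e u <= degree e v.
  move=> gen; have [|/ltnW] := leqP (degree e u) (degree e v); first exact: gen.
  apply: gen; first by move: uvP; rewrite /nonadj /= eq_sym e_sym.
  by move=> z /maxuv /=; rewrite [degree e v + _]addnC.
have /andP[/= uv euv] := uvP.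
have degT : #|T| <= degree e u + degree e v.
  apply: degree_sum_of_extremal => // w wv ewv.
  by have := maxuv (w, v); rewrite /nonadj /= wv ewv leq_add2r; apply.
have sub_e x y : e x y -> add_edge e u v x y by rewrite /add_edge => ->.
apply: (hamiltonian_add_edge e_sym e_irr uv degT gtT); apply: IHN.
- apply: leq_trans (_ : #|[set z : T * T | ~~ e z.1 z.2]| <= N); last exact: ltN.
  apply: proper_card; apply/properP; split.
    by apply/subsetP => z; rewrite !inE; apply: contraNN; apply: sub_e.
  by exists (u, v); rewrite !inE //= negbK /add_edge !eqxx orbT.
- move=> x y; rewrite /add_edge e_sym; congr (_ || _).
  by rewrite orbC ![_ && (x == _)]andbC.
- move=> x; rewrite /add_edge e_irr /=; apply/negbTE; apply/negP.
  by case/orP=> /andP[/eqP Dx /eqP Dv]; rewrite -Dx Dv eqxx in uv.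
apply: leq_trans few; rewrite !leq_add2r; apply: leq_sum => x _.
apply: subset_leq_card; apply/subsetP => y; rewrite !inE /missing.
by case: (f x != f y) => //=; apply: contraNN; apply: sub_e.
Qed.
End FewMissing.

(** The form used below, for the subgraph left after deleting a few vertices. *)
Lemma hamiltonian_induced (T : finType) (I : eqType) (f : T -> I) s (e : rel T)
    (S : {set T}) :
  symmetric e -> irreflexive e ->
  (forall x, #|[set y | f y == f x]| <= s) -> 2 * s <= #|S| ->
  arcs (missing e f) S S + 2 * s + 4 <= 2 * #|S| ->
  exists c, [/\ ucycle e c, size c = #|S| & c =i S].
Proof.
move=> e_sym e_irr cls s_half few.
pose T' := {x | x \in S}; pose e' : rel T' := relpre val e.
have cardT' : #|{: T'}| = #|S| by rewrite card_sig.
have [|||||c /andP[cyc uc] szc] := @hamiltonian_of_few_missing T' I (f \o val) s _ _ e'.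
- move=> x; apply: leq_trans (cls (val x)).
  rewrite -(card_imset _ val_inj); apply: subset_leq_card.
  by apply/subsetP=> z /imsetP[y]; rewrite !inE => fy ->.
- by rewrite cardT'.
- by move=> x y; apply: e_sym.
- by move=> x; apply: e_irr.
- rewrite cardT'; apply: leq_trans few; rewrite !leq_add2r /arcs.
  rewrite [leqRHS]big_sub; apply: leq_sum => x _.
  by rewrite degreeE [leqRHS]big_sub.
exists (map val c); split; last 1 first.
- move=> x; apply/mapP/idP => [[y _ ->]|xS]; first exact: valP.
  by exists (Sub x xS); rewrite ?SubK // spanning_mem.
- by rewrite /ucycle (map_inj_uniq val_inj) uc andbT cycle_map.
by rewrite size_map szc.
Qed.

(** * Chorded cycles through arcs of a cycle *)

(** A vertex has only two neighbours along a cycle, so a third one gives a chord. *)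
Lemma chorded_of_three_neighbours (T : finType) (e : rel T) (c s : seq T) (x : T) :
  graph_cycle e c -> x \in c -> uniq s -> 2 < size s -> {subset s <= c} ->
  all (e x) s -> chorded_cycle e (size c).
Proof.
move=> gc xc us szs sc exs; exists c; split=> //; exists x.
have [/hasP[y ys]|none] := boolP (has (fun y => y \notin [:: next c x; prev c x]) s).
  rewrite !inE negb_or => /andP[ynx ypx]; exists y; split=> //.
  - exact: sc.
  - exact: (allP exs).
  by apply: contraNneq ypx => ->; rewrite prev_next //; case: gc => /andP[].
have /(uniq_leq_size us) : {subset s <= [:: next c x; prev c x]}.
  by move=> y ys; have := hasPn none y ys; rewrite negbK.
by rewrite leqNgt szs.
Qed.

Lemma nth_rot (T : Type) (x0 : T) (c : seq T) i j :
  i <= size c -> j < size c -> nth x0 (rot i c) j = nth x0 c ((i + j) %% size c).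
Proof.
move=> ic jc; rewrite /rot nth_cat size_drop nth_drop.
case: ltnP => [lt|ge]; first by rewrite modn_small //; lia.
rewrite nth_take; last by lia.
have -> : i + j = (j - (size c - i)) + size c by lia.
by rewrite modnDr modn_small //; lia.
Qed.

Section Translates.
Variables (Z : finType) (A : {set Z}) (tau : Z -> Z).
Hypothesis tau_inj : injective tau.

(** Inclusion-exclusion on [A] and its preimage, which has the same size. *)
Lemma card_preimset_meet : 2 * #|A| <= #|Z| + #|[set i in A | tau i \in A]|.
Proof.
have := cardsUI A (tau @^-1: A); rewrite card_preimset //.
have -> : A :&: tau @^-1: A = [set i in A | tau i \in A].
  by apply/setP=> i; rewrite !inE.
by have := subset_leq_card (subsetT (A :|: tau @^-1: A)); rewrite cardsT; lia.
Qed.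

Lemma pair_of_density : #|Z| < 2 * #|A| -> exists i, (i \in A) && (tau i \in A).
Proof.
move=> ltA; have /card_gt0P[i] : 0 < #|[set i in A | tau i \in A]|.
  by have := card_preimset_meet; lia.
by rewrite inE; exists i.
Qed.

(** Let [X] be the set of [i] with [i] and [tau i] in [A].  If the conclusion fails,
    [sigma @: X] and [sigma @: (sigma @: X)] avoid [A], and they are disjoint because
    [X] is inside [A] and [sigma @: X] avoids it.  So [2 * #|X| <= #|Z| - #|A|], whereas
    [2 * #|A| - #|Z| <= #|X|]. *)
Lemma triple_of_density (sigma : Z -> Z) : injective sigma ->
  3 * #|Z| < 5 * #|A| ->
  exists i, [&& i \in A, tau i \in A & (sigma i \in A) || (sigma (sigma i) \in A)].
Proof.
move=> sigma_inj ltA; apply/existsP; apply: contraLR ltA.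
rewrite negb_exists => /forallP none; rewrite -leqNgt.
pose X := [set i in A | tau i \in A].
have Xg i : i \in X -> (sigma i \notin A) && (sigma (sigma i) \notin A).
  by rewrite inE => /andP[iA iaA]; have := none i; rewrite iA iaA negb_or.
pose X1 := sigma @: X; pose X2 := sigma @: X1.
have card1 : #|X1| = #|X| by rewrite card_imset.
have card2 : #|X2| = #|X| by rewrite card_imset.
have sub1 : X1 \subset ~: A.
  by apply/subsetP=> z /imsetP[i /Xg/andP[g1 _] ->]; rewrite inE.
have sub2 : X2 \subset ~: A.
  by apply/subsetP=> z /imsetP[_ /imsetP[i /Xg/andP[_ g2] ->] ->]; rewrite inE.
have disj : X1 :&: X2 = set0.
  apply/setP=> z; rewrite !inE; apply/andP=> -[/imsetP[i iX ->] /imsetP[j jX1]].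
  move/sigma_inj=> Di; have := subsetP sub1 _ jX1.
  by rewrite -Di inE; move: iX; rewrite inE => /andP[->].
have sub : X1 :|: X2 \subset ~: A by rewrite subUset sub1.
have := subset_leq_card sub; have := cardsUI X1 X2; rewrite disj cards0.
have := cardsC A; have : 2 * #|A| <= #|Z| + #|X| := card_preimset_meet.
lia.
Qed.
End Translates.

Section Around.
Variables (T : finType) (e : rel T) (v : T) (c : seq T).
Hypotheses (e_sym : symmetric e) (cyc : cycle e c) (uc : uniq c) (vc : v \notin c).

Definition detour i a : seq T := v :: take a.+1 (rot i c).

Lemma detour_cycle i a :
  i < size c -> 0 < a < size c ->
  e v (nth v c i) -> e v (nth v c ((i + a) %% size c)) ->
  graph_cycle e (detour i a).
Proof.
move=> ic /andP[a_gt0 ac] evi eva.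
have sz : size (take a.+1 (rot i c)) = a.+1 by rewrite size_takel // size_rot.
split; last by rewrite /= sz.
have : cycle e (rot i c) by rewrite rot_cycle.
have : uniq (rot i c) by rewrite rot_uniq.
have hd : nth v (rot i c) 0 = nth v c i by rewrite nth_rot ?addn0 ?modn_small //; lia.
have la := nth_rot v (ltnW ic) ac.
have vr : v \notin rot i c by rewrite mem_rot.
move: hd la vr sz; rewrite /detour.
case: (rot i c) => [|x p] //= hd la vr [sz] /andP[xp up].
rewrite rcons_path => /andP[pxp _].
move: vr; rewrite inE => /norP[vx vp].
have vtp : v \notin take a p by apply: contraNN vp => /mem_take.
have xtp : x \notin take a p by apply: contraNN xp => /mem_take.
have last_arc : last x (take a p) = nth v c ((i + a) %% size c).
  by rewrite (last_nth v) sz -la -(@nth_take a.+1 _ v a _ (x :: p)).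
rewrite /ucycle /= inE negb_or vx vtp xtp take_uniq // andbT hd evi /= -hd.
by rewrite rcons_path take_path //= last_arc e_sym eva.
Qed.

Let q := size c.

Lemma val_iter_ordS n a (i : 'I_n) : val (iter a (@ordS n) i) = (i + a) %% n.
Proof.
elim: a => [|a IHa]; first by rewrite addn0 modn_small.
by rewrite iterS /= IHa -addn1 modnDml addn1 addnS.
Qed.

Lemma iter_ordS_inj n a : injective (iter a (@ordS n)).
Proof. by elim: a => [|a IHa] i j //=; move/ordS_inj/IHa. Qed.

Let A : {set 'I_q} := [set i : 'I_q | e v (nth v c i)].

Lemma card_neighbour_positions : #|A| = count (e v) c.
Proof. by rewrite -sum1_count (big_nth v) big_mkord sum1dep_card. Qed.

(** Two consecutive vertices of [c] are adjacent to [v]. *)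
Lemma triangle_around :
  1 < q -> q < 2 * count (e v) c -> exists x y, [/\ e v x, e x y & e y v].
Proof.
move=> q_gt1; rewrite -card_neighbour_positions => many.
have [|i] := @pair_of_density _ A (@ordS q) (@ordS_inj q); first by rewrite card_ord.
rewrite !inE /= -addn1 => /andP[evi evi1].
have [/andP[cyc' _] _] := detour_cycle (ltn_ord i) (q_gt1 : 0 < 1 < q) evi evi1.
have : 1 < size (rot i c) by rewrite size_rot.
move: cyc'; rewrite /detour; case: (rot i c) => [|x [|y p]] //=.
by rewrite take0 /= andbT => /and3P[evx exy eyv] _; exists x, y.
Qed.

(** With [a = t - 2], [triple_of_density] finds an arc whose ends and whose second or
    third vertex are adjacent to [v]; as [a > 2], the latter is an inner vertex. *)
Lemma chorded_around t :
  3 * q < 5 * count (e v) c -> 4 < t <= q.+1 -> chorded_cycle e t.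
Proof.
rewrite -card_neighbour_positions => many /andP[t_gt4 t_le].
pose a := t - 2.
have [|i] := @triple_of_density _ A (iter a (@ordS q)) (@iter_ordS_inj q a) _ (@ordS_inj q).
  by rewrite card_ord.
rewrite !inE val_iter_ordS => /and3P[evi eva ev12].
have [j j12 evj] : exists2 j, 0 < j < 3 & e v (nth v (rot i c) j).
  have lt_iq := ltn_ord i.
  case/orP: ev12 => evj; [exists 1 | exists 2] => //; rewrite nth_rot -/q; try lia.
    by rewrite addn1.
  by move: evj; rewrite /= -addn1 modnDml addn1 addn2.
have a_lt : 0 < a < size c by rewrite -/q; lia.
have gc := detour_cycle (ltn_ord i) a_lt evi eva.
have szt : size (take a.+1 (rot i c)) = a.+1.
  by rewrite size_takel // size_rot -/q; lia.
have Dt : t = size (detour i a) by rewrite /= szt; lia.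
pose s := [seq nth v (rot i c) k | k <- [:: 0; j; a]].
have sub_s k : k <= a -> nth v (rot i c) k \in take a.+1 (rot i c).
  by move=> ka; rewrite -(nth_take v (n0 := a.+1)) // mem_nth // szt.
rewrite Dt; apply: (@chorded_of_three_neighbours _ e _ s v) => //.
- by rewrite inE eqxx.
- by rewrite /s /= !inE !nth_uniq ?rot_uniq // ?size_rot -/q; lia.
- move=> x /mapP[k k3 ->]; rewrite inE sub_s ?orbT //.
  by move: k3; rewrite !inE; lia.
have lt_iq := ltn_ord i.
rewrite /= evj !nth_rot -/q; try lia.
by rewrite addn0 modn_small // evi eva.
Qed.
End Around.

Lemma chorded_of_two_triangles (T : finType) (e : rel T) x y z w :
  symmetric e -> irreflexive e ->
  e x y -> e x z -> e y z -> e w x -> e w y -> w != z -> chorded_cycle e 4.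
Proof.
move=> e_sym e_irr exy exz eyz ewx ewy wz.
have ne a b : e a b -> a != b by apply: contraTneq => ->; rewrite e_irr.
have u4 : uniq [:: w; x; z; y].
  by rewrite /= !inE !negb_or wz !ne // e_sym.
apply: (@chorded_of_three_neighbours _ e [:: w; x; z; y] [:: w; z; y] x) => //.
- by split; rewrite // /ucycle u4 /= ewx exz e_sym eyz e_sym ewy.
- by rewrite !inE eqxx orbT.
- by move: u4; rewrite /= !inE !negb_or => /and3P[/and3P[_ -> ->] _ ->].
- by move=> a; rewrite !inE => /or3P[] ->; rewrite ?orbT.
by rewrite /= e_sym ewx exz exy.
Qed.

(** The degree sum counts each vertex of the triangle twice, so some other vertex is
    counted at least twice, and two triangles share an edge. *)
Lemma chorded_4cycle_of_triangle (T : finType) (e : rel T) x y z :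
  symmetric e -> irreflexive e -> e x y -> e y z -> e z x ->
  #|T| + 3 < degree e x + degree e y + degree e z -> chorded_cycle e 4.
Proof.
move=> e_sym e_irr exy eyz ezx.
rewrite !degreeE -!big_split /= => many.
have ne a b : e a b -> a != b by apply: contraTneq => ->; rewrite e_irr.
have [w|none] := pickP (fun w => (w \notin [set x; y; z]) && (1 < e x w + e y w + e z w)).
  rewrite !inE !negb_or => /andP[/andP[/andP[wx wy] wz]].
  case exw: (e x w); case eyw: (e y w); case ezw: (e z w) => // _.
  - by apply: (@chorded_of_two_triangles _ e x y z w); rewrite // e_sym.
  - by apply: (@chorded_of_two_triangles _ e x y z w); rewrite // e_sym.
  - by apply: (@chorded_of_two_triangles _ e x z y w); rewrite // e_sym.
  - by apply: (@chorded_of_two_triangles _ e y z x w); rewrite // e_sym.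
exfalso; move: many; apply/negP; rewrite -leqNgt.
have -> : #|T| + 3 = \sum_w (1 + (w \in [set x; y; z])).
  rewrite big_split /= sum1_card; congr (_ + _).
  have -> : \sum_i (i \in [set x; y; z]) = #|[set x; y; z]|.
    by rewrite -sum1_card [RHS]big_mkcond; apply: eq_bigr => i _; case: (i \in _).
  by rewrite -setUA cardsU1 cards2 !inE negb_or !ne // e_sym.
apply: leq_sum => w _; have := none w; case: (boolP (w \in _)) => /= [|_].
  rewrite !inE => /orP[/orP[]|] /eqP-> _; rewrite e_irr.
  - by case: (e y x); case: (e z x).
  - by case: (e x y); case: (e z y).
  - by case: (e x z); case: (e y z).
by move/negbT; rewrite -leqNgt addn0.
Qed.

(** * Chorded pancyclicity with few missing pairs *)

Lemma exists_le_average (T : finType) (r : T -> nat) (m : nat) :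
  \sum_x r x < #|T| * m.+1 -> exists x, r x <= m.
Proof.
move=> lt_sum; apply/existsP; apply: contraLR lt_sum.
rewrite negb_exists -leqNgt => /forallP big.
rewrite -sum_nat_const; apply: leq_sum => x _.
by rewrite ltnNge big.
Qed.

Lemma chorded_of_spanning_cycle (T : finType) (e : rel T) (S : {set T}) c x :
  ucycle e c -> size c = #|S| -> c =i S -> x \in S ->
  2 < #|[set y in S | e x y]| -> chorded_cycle e #|S|.
Proof.
move=> uc szc cS xS deg3; rewrite -szc.
apply: (chorded_of_three_neighbours (x := x) (s := enum [set y in S | e x y])).
- split=> //; rewrite szc (leq_trans deg3) // subset_leq_card //.
  by apply/subsetP=> y; rewrite inE => /andP[].
- by rewrite cS.
- exact: enum_uniq.
- by rewrite -cardE.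
- by move=> y; rewrite mem_enum inE cS => /andP[].
by apply/allP=> y; rewrite mem_enum inE => /andP[].
Qed.

Section FewMissingPancyclic.
Variables (T : finType) (I : eqType) (f : T -> I) (e : rel T) (n p : nat).
Hypotheses (e_sym : symmetric e) (e_irr : irreflexive e).
Hypothesis class_le : forall x, #|[set y | f y == f x]| <= n.
Hypothesis cardT : #|T| = p.
Hypothesis third : 3 * n <= p.
Local Notation r := (missing e f).
Hypothesis few : \sum_x degree r x + 2 * n + 4 <= 2 * p.

Let r_sym : symmetric r. Proof. exact: missing_sym. Qed.
Let r_irr x : r x x = false. Proof. by rewrite /r /missing eqxx. Qed.
Let deg x : p <= degree e x + degree r x + n.
Proof. by rewrite -cardT; exact: degree_missing (class_le x). Qed.

Lemma class_gt0 : 0 < p -> 0 < n.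
Proof.
rewrite -cardT => /card_gt0P[x _]; apply: leq_trans (class_le x).
by apply/card_gt0P; exists x; rewrite inE.
Qed.

(** If all degrees were at most 2, every vertex would miss at least [p - n - 2] others,
    and the total would exceed [2 * (p - n - 2)] since [p > 2] and
    [p - n > 2]. *)
Lemma chorded_hamiltonian : 3 < p -> chorded_cycle e p.
Proof.
move=> gtT; have n_gt0 := class_gt0 (ltnW (ltnW (ltnW gtT))).
have [x xP] : exists x, degree r x <= p - n - 3.
  apply: exists_le_average; rewrite cardT -subSn; last by lia.
  have [K DK] : exists K, p = n + 3 + K by exists (p - n - 3); lia.
  have -> : (p - n).+1 - 3 = K.+1 by lia.
  by move: few third gtT; rewrite {}DK; nia.
have [||c [cyc szc cT]] := @hamiltonian_induced T I f n e setT e_sym e_irr class_le.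
- by rewrite cardsT cardT; lia.
- rewrite cardsT cardT arcs_setT; apply: leq_trans few.
  by rewrite !leq_add2r; apply: eq_leq; apply: eq_bigl => y; rewrite inE.
have := chorded_of_spanning_cycle cyc szc cT (in_setT x); rewrite cardsT cardT; apply.
have -> : #|[set y in setT | e x y]| = degree e x.
  by apply: eq_card => y; rewrite !inE.
by have := deg x; lia.
Qed.

(** Adjacent vertices miss distinct pairs, so together the vertices of a triangle miss
    at most [p - n - 2], and their degree sum is at least [2 * (p - n) + 2]. *)
Lemma chorded_4cycle x y z :
  3 < p -> e x y -> e y z -> e z x -> chorded_cycle e 4.
Proof.
move=> gtT exy eyz ezx; have n_gt0 := class_gt0 (ltnW (ltnW (ltnW gtT))).
apply: (chorded_4cycle_of_triangle e_sym e_irr exy eyz ezx); rewrite cardT.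
have ne a b : e a b -> a != b by apply: contraTneq => ->; rewrite e_irr.
have adj a b : e a b -> r a b = false by rewrite /r /missing => ->; rewrite andbF.
have W0 : {in [set x; y; z] &, forall a b, ~~ r a b}.
  move=> a b; rewrite !inE => /orP[/orP[]|] /eqP-> /orP[/orP[]|] /eqP->;
    by rewrite ?r_irr ?adj // e_sym.
have := degree_sum_stable r_sym W0; rewrite -setUA !big_setU1 ?big_set1 /=.
- by have := deg x; have := deg y; have := deg z; lia.
- by rewrite !inE ne.
by rewrite !inE negb_or !ne // e_sym.
Qed.

(** The Hamiltonian cycle of the graph without [x] has length [p - 1] and contains all
    the [p - n - 1] or more neighbours of [x]; this exceeds [3 * (p - 1) / 5] unless
    [n = 2] and [p = 6]. *)
Lemma chorded_of_one_missing x t :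
  degree r x = 1 -> 4 <= t < p -> chorded_cycle e t.
Proof.
move=> rx1 /andP[t_ge4 t_lt]; have n_gt0 : 0 < n by apply: class_gt0; lia.
have cardS : #|[set~ x]| = p - 1 by rewrite cardsC1 cardT subn1.
have := arcs_compl r_sym [set x].
rewrite arcs_stable; last by move=> a b; rewrite !inE => /eqP-> /eqP->; rewrite r_irr.
rewrite big_set1 rx1 => arcsS.
have [||c [/andP[cyc uc] szc cS]] :=
    @hamiltonian_induced T I f n e [set~ x] e_sym e_irr class_le.
- by rewrite cardS; lia.
- by rewrite cardS; lia.
rewrite cardS in szc.
have xc : x \notin c by rewrite cS !inE eqxx.
have cntx : count (e x) c = degree e x.
  rewrite count_card //; apply: eq_card => y; rewrite !inE cS !inE.
  by case: eqVneq => // ->; rewrite e_irr.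
have degx := deg x.
have [t4|t_gt4] := leqP t 4.
  have -> : t = 4 by lia.
  have [|| a [b [exa eab ebx]]] :=
    triangle_around e_sym cyc uc xc; rewrite ?szc ?cntx; try lia.
  by apply: (chorded_4cycle _ exa eab ebx); lia.
have [small|large] := leqP (5 * count (e x) c) (3 * size c); last first.
  by apply: (chorded_around e_sym cyc uc xc) => //; rewrite szc; lia.
(* The density condition fails only for [n = 2] and [p = 6], so [t = 5 = p - 1].  Some
   [y] misses nothing; at least 3 of its 4 or more neighbours lie on the cycle. *)
have [Dn DT] : n = 2 /\ p = 6 by lia.
have -> : t = #|[set~ x]| by rewrite cardS; lia.
have [|y ry0] := @exists_le_average T (degree r) 0; first by rewrite cardT; lia.
have yS : y \in [set~ x] by rewrite !inE; apply: contraTneq ry0 => ->; rewrite rx1.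
apply: (chorded_of_spanning_cycle _ _ cS yS); rewrite ?cardS ?/ucycle ?cyc //.
have : degree e y <= #|[set z in [set~ x] | e y z]|.+1.
  rewrite /degree (cardsD1 x) -add1n leq_add ?leq_b1 //.
  by apply: subset_leq_card; apply/subsetP=> z; rewrite !inE.
by have := deg y; lia.
Qed.

(** Some [v] misses nothing.  Deleting [v] alone could leave one missing pair too many
    for a Hamiltonian cycle; deleting also a vertex that misses at least two makes up
    for this, at the cost of at most one neighbour of [v] and of the length [p], which
    is obtained separately. *)
Lemma chorded_of_no_one_missing t :
  (forall x, degree r x != 1) -> 4 <= t < p -> chorded_cycle e t.
Proof.
move=> no1 /andP[t_ge4 t_lt]; have n_gt0 : 0 < n by apply: class_gt0; lia.
have [|v rv1] := @exists_le_average T (degree r) 1; first by rewrite cardT; lia.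
have rv0 : degree r v = 0 by have := no1 v; lia.
have rv y : r v y = false.
  apply: contraTF rv1 => rvy; rewrite -ltnNge ltn_neqAle eq_sym no1.
  by apply/card_gt0P; exists y; rewrite inE.
have [x xv xP] : exists2 x, x != v &
    \sum_y degree r y + 2 * n + 8 <= 2 * p + 2 * degree r x.
  have [x rx|all0] := pickP (fun x => 0 < degree r x).
    exists x; first by apply: contraTneq rx => ->; rewrite rv0.
    by have := no1 x; lia.
  have /card_gt0P[x] : 0 < #|[set~ v]| by rewrite cardsC1 cardT; lia.
  rewrite !inE => xv; exists x => //.
  have -> : \sum_x degree r x = 0 by apply: big1 => y _; have := all0 y; lia.
  by lia.
have cardS : #|~: [set x; v]| = p - 2.
  by have := cardsC [set x; v]; rewrite cards2 xv cardT; lia.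
have := arcs_compl r_sym [set x; v].
rewrite arcs_stable; last first.
  move=> a b; rewrite !inE => /orP[] /eqP-> /orP[] /eqP->;
    by rewrite ?r_irr ?rv // r_sym rv.
rewrite big_setU1 ?inE //= big_set1 rv0 => arcsS.
have [||c [/andP[cyc uc] szc cS]] :=
    @hamiltonian_induced T I f n e (~: [set x; v]) e_sym e_irr class_le.
- by rewrite cardS; lia.
- by rewrite cardS; lia.
rewrite cardS in szc.
have vc : v \notin c by rewrite cS !inE eqxx orbT.
have cntv : degree e v <= (count (e v) c).+1.
  rewrite count_card // /degree (cardsD1 x) -add1n leq_add ?leq_b1 //.
  apply: subset_leq_card; apply/subsetP=> y; rewrite !inE cS !inE => /andP[yx evy].
  by rewrite evy (negbTE yx) /= andbT; apply: contraTneq evy => ->; rewrite e_irr.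
have degv := deg v.
have [t4|t_gt4] := leqP t 4.
  have -> : t = 4 by lia.
  have [|| a [b [eva eab ebv]]] := triangle_around e_sym cyc uc vc; rewrite ?szc; try lia.
  by apply: (chorded_4cycle _ eva eab ebv); lia.
by apply: (chorded_around e_sym cyc uc vc); rewrite szc; lia.
Qed.

Theorem chorded_pancyclic_of_few_missing : chorded_pancyclic e.
Proof.
move=> t; rewrite cardT => /andP[t_ge4]; rewrite leq_eqVlt => /predU1P[Dt|t_lt].
  by rewrite Dt; apply: chorded_hamiltonian; rewrite -Dt.
have tP : 4 <= t < p by rewrite t_ge4.
have [x /eqP rx1|none] := pickP (fun x => degree r x == 1).
  exact: chorded_of_one_missing rx1 tP.
by apply: chorded_of_no_one_missing tP => x; rewrite none.
Qed.
End FewMissingPancyclic.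

(** * From the number of edges to the number of missing pairs *)

(** Every edge is the set of ends of at least two ordered pairs. *)
Lemma double_edges_le (T : finType) (e : rel T) :
  symmetric e -> irreflexive e -> 2 * #|edges e| <= \sum_x degree e x.
Proof.
move=> e_sym e_irr; pose P (z : T * T) := e z.1 z.2.
have -> : \sum_x degree e x = \sum_(z | P z) 1.
  rewrite (eq_bigr (fun x => \sum_y e x y)); last by move=> x _; exact: degreeE.
  rewrite pair_big /= [RHS]big_mkcond; apply: eq_bigr => -[x y] _.
  by rewrite /P /=; case: (e x y).
rewrite (partition_big (fun z => [set z.1; z.2]) (mem (edges e))) /=; last first.
  by move=> [x y] exy; apply/imset2P; exists x y.
rewrite mulnC -sum_nat_const; apply: leq_sum => _ /imset2P[x y _ exy ->].
rewrite unfold_in in exy.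
have xy : x != y by apply: contraTneq exy => ->; rewrite e_irr.
have <- : #|[set (x, y); (y, x)]| = 2 by rewrite cards2 xpair_eqE (negbTE xy).
rewrite sum1dep_card; apply/subset_leq_card/subsetP=> z.
rewrite !inE => /orP[] /eqP-> /=; rewrite /P /=.
  by rewrite eqxx andbT.
by rewrite e_sym setUC eqxx andbT.
Qed.

Import GRing.Theory Num.Theory.
Local Open Scope ring_scope.

Theorem corollary17 (k n : nat) (T : finType) (e : rel T)
    (hk : (3 <= k)%N) (hn : (1 <= n)%N)
    (e_sym : symmetric e) (e_irr : irreflexive e)
    (hbal : balanced_kpartite e k) (hord : #|T| = (k * n)%N)
    (hedges : ((k%:R ^+ 2 - k%:R) * n%:R ^+ 2 - 2 * n%:R * (k%:R - 1) + 4) / 2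
                <= #|edges e|%:R :> rat) :
  chorded_pancyclic e.
Proof.
case: hbal => f part bal.
have class x : #|[set y | f y == f x]| = n.
  have : #|T| = (\sum_(i < k) #|[set y | f y == i]|)%N.
    rewrite -sum1_card (partition_big f xpredT) //=.
    by apply: eq_bigr => i _; rewrite sum1dep_card.
  rewrite (eq_bigr (fun _ => #|[set y | f y == f x]|)); last by move=> i _; exact: bal.
  rewrite sum_nat_const card_ord hord => /eqP.
  by rewrite eqn_pmul2l; [move/eqP|lia].
have deg x : (degree e x + degree (missing e f) x + n = k * n)%N.
  have Dn : n = degree (fun u y => f y == f u) x := esym (class x).
  rewrite -hord -sum1_card [in LHS]Dn !degreeE -!big_split /=.
  apply: eq_bigr => y _; have := part x y; rewrite /missing eq_sym.
  by case: (e x y) => [/(_ isT)/negbTE->|_] //; case: (f y == f x).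
have degsum : (\sum_x degree e x + \sum_x degree (missing e f) x + k * n * n
                = k * n * (k * n))%N.
  rewrite -{1 2}hord -!sum_nat_const -!big_split /=.
  by apply: eq_bigr => x _; exact: deg.
have edges_ge : (k * (k * (n * n)) + 2 * n + 4
                 <= 2 * #|edges e| + k * (n * n) + 2 * (n * k))%N.
  move: hedges; rewrite ler_pdivrMr // => hedges.
  rewrite -(ler_nat rat) !natrD !natrM; lra.
have two_edges := double_edges_le e_sym e_irr.
apply: (chorded_pancyclic_of_few_missing (f := f) (n := n) e_sym e_irr _ (erefl _)).
- by move=> x; rewrite class.
- by rewrite hord leq_mul2r hk orbT.
by rewrite hord; nia.
Qed.
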